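(* Let $\Sigma$ be a finite signed graph with vertex set $V$, and let $\Sigma^+=(V,E^+)$ be its positive subgraph. Then every two distinct weakly negative circles of $\Sigma$ are edge disjoint if and only if both of the following hold: (a) every negative edge of $\Sigma$, with endpoints $u,v$, either has $u$ and $v$ in different connected components of $\Sigma^+$, or has $u$ and $v$ in the same connected component (tree) $T$ of the forest $F(\Sigma^+)$; (b) for every connected component (tree) $T$ of $F(\Sigma^+)$, the graph consisting of $T$ together with all negative edges of $\Sigma$ having both endpoints in $T$ is a cactus.
   Context: A signed graph $\Sigma=(\Gamma,\sigma)$ consists of a graph $\Gamma=(V,E)$ (multiple edges allowed, no loops) and a sign function $\sigma:E\to\{+,-\}$. A circle is a cycle (polygon) of the graph; with multiple edges, two parallel edges form a circle of length 2. A circle is weakly negative if exactly one of its edges is negative. The positive subgraph is $\Sigma^+=(V,E^+)$ where $E^+=\sigma^{-1}(+)$. An isthmus of a graph is an edge whose removal increases the number of connected components. $F(\Sigma^+)$ denotes the forest $(V,E_F)$ where $E_F$ is the set of isthmi of $\Sigma^+$ (equivalently, the union of the trivial blocks, i.e. blocks isomorphic to $K_1$ or $K_2$, of $\Sigma^+$); its connected components are trees (possibly single vertices). A cactus is a connected graph all of whose blocks (maximal subgraphs without cut vertices) are circles or isthmi. *)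

(* Defs.v *)
From mathcomp Require Import all_boot.

Set Implicit Arguments.
Unset Strict Implicit.
Unset Printing Implicit Defensive.

(* Finite loopless multigraphs: an edge has exactly two endpoints, and several
   edges may have the same endpoints. *)
Record mgraph := MGraph {
  vertex : finType;
  edge : finType;
  ends : edge -> {set vertex};
  card_ends : forall e, #|ends e| = 2
}.

(* The second field plays the role of sigma: [negative e] holds iff
   sigma(e) = -, and fails iff sigma(e) = +. *)
Record signed_graph := SignedGraph {
  underlying :> mgraph;
  negative : pred (edge underlying)
}.

(* The graphs below are all subgraphs of a fixed ambient multigraph.  The last
   field is boolean, so subgraphs with the same vertices and the same edges are
   equal. *)
Record subgraph (G : mgraph) := Subgraph {
  vset : {set vertex G};
  eset : {set edge G};
  ends_sub : [forall e in eset, ends e \subset vset]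
}.

Section Subgraphs.

Variable G : mgraph.
Implicit Types (H K L C : subgraph G) (x y : vertex G) (e : edge G).

Fact restrict_subproof (A : {set vertex G}) (B : {set edge G}) :
  [forall e in [set e in B | ends e \subset A], ends e \subset A].
Proof. by apply/forall_inP => e; rewrite inE => /andP[]. Qed.

(* Vertex set A, with the edges of B that have both endpoints in A. *)
Definition restrict (A : {set vertex G}) (B : {set edge G}) : subgraph G :=
  Subgraph (restrict_subproof A B).

Definition subgraph_le K H : bool :=
  (vset K \subset vset H) && (eset K \subset eset H).

Definition adj H : rel (vertex G) :=
  [rel x y | [exists e in eset H, ends e == [set x; y]]].

(* A connected component is represented by its set of vertices. *)
Definition components H : {set {set vertex G}} :=
  equivalence_partition (connect (adj H)) (vset H).

Definition component_of H x : {set vertex G} := pblock (components H) x.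

Definition connected H : Prop := #|components H| = 1.

Definition del_vertex H x := restrict (vset H :\ x) (eset H).

Definition del_edge H e := restrict (vset H) (eset H :\ e).

Definition cut_vertex H x : bool :=
  (x \in vset H) && (#|components H| < #|components (del_vertex H x)|).

Definition isthmus H e : bool :=
  (e \in eset H) && (#|components H| < #|components (del_edge H e)|).

(* Vertices x_0, ..., x_(n-1) and edges a_0, ..., a_(n-1), all distinct, with
   a_i joining x_i to x_(i+1 mod n).  The case n = 2 is a pair of parallel
   edges. *)
Definition circle C : Prop :=
  exists (n : nat) (x : 'I_n -> vertex G) (a : 'I_n -> edge G),
    [/\ 1 < n, injective x, injective a,
        forall i, ends (a i) = [set x i; x (ordS i)]
      & vset C = [set x i | i : 'I_n] /\ eset C = [set a i | i : 'I_n]].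

Definition nonseparable K : Prop :=
  connected K /\ forall x, ~~ cut_vertex K x.

Definition block H K : Prop :=
  [/\ subgraph_le K H, nonseparable K
    & forall L, subgraph_le L H -> nonseparable L -> subgraph_le K L -> L = K].

(* The last alternative allows the trivial block K_1.  In a connected graph it
   occurs only when the whole graph is a single vertex, which is thus a
   cactus. *)
Definition cactus H : Prop :=
  connected H /\
  forall K, block H K ->
    [\/ circle K,
        exists e, [/\ isthmus H e, vset K = ends e & eset K = [set e]]
      | #|vset K| = 1].

End Subgraphs.

Section Signed.

Variable S : signed_graph.

Definition negative_edges : {set edge S} := [set e | negative e].

Definition weakly_negative (C : subgraph S) : Prop :=
  #|eset C :&: negative_edges| = 1.

Definition positive_subgraph : subgraph S := restrict setT (~: negative_edges).

Definition isthmus_forest : subgraph S :=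
  restrict setT [set e | isthmus positive_subgraph e].

(* For T a component of the forest: the tree on T together with all negative
   edges having both endpoints in T. *)
Definition tree_with_negative_edges (T : {set vertex S}) : subgraph S :=
  restrict T (eset isthmus_forest :|: negative_edges).

End Signed.

(* Main.v *)
(** An isthmus g of the positive subgraph determines a vertex set A_g such that
    g is the only positive edge crossing A_g.  Hence a weakly negative circle
    whose negative edge crosses A_g contains g.

    If the weakly negative circles are edge disjoint, then for a tree T of the
    isthmus forest the cut of T plus its negative edges at A_g is {g}, or lies
    in the one weakly negative circle through g.  In the first case g is an
    isthmus and forms a block.  In the second case any two vertices of a weakly
    negative circle C are separated by such a cut, so that nothing outside C
    joins them and C is a block.

    Conversely, let C be a weakly negative circle with negative edge f = uv.  The
    circle formed by f and a path of isthmi from u to v has all its edges in C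
    and so equals C; thus C lies in a tree plus its negative edges.  Two such
    circles with a common edge have a nonseparable union, hence lie in one
    block, which is a circle, and both equal it. *)
Require Import Defs.
From mathcomp Require Import all_boot zify.

Set Implicit Arguments.
Unset Strict Implicit.
Unset Printing Implicit Defensive.

(** * Induction around a cycle *)

Lemma val_iter_ordS n (k : 'I_n) t : val (iter t (@ordS n) k) = (k + t) %% n.
Proof.
elim: t => [|t IH] /=; first by rewrite addn0 modn_small.
by rewrite IH -addn1 modnDml addn1 addnS.
Qed.

(** The successors of [ordS k] run through all indices and reach [k] last, so the step out of [k] is
    never taken. With the edge or vertex at [k] deleted, this walks along what is left of a
    circle. *)
Lemma ordS_ind n (k : 'I_n) (P : 'I_n -> Prop) :
  P (ordS k) -> (forall i, i != k -> P i -> P (ordS i)) -> forall i, P i.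
Proof.
move=> P0 PS; have n_gt0 : 0 < n by case: n k {P P0 PS} => [[]|].
have Pt t : t < n -> P (iter t.+1 (@ordS n) k).
  elim: t => [//|t IH] lt_t_n; rewrite iterS; apply: PS; last exact/IH/ltnW.
  apply/eqP => /(congr1 val); rewrite val_iter_ordS => /eqP.
  rewrite -[X in _ == X]/(val k) -[X in _ == X](modn_small (ltn_ord k)).
  by rewrite -[X in _ == X %[mod _]]addn0 eqn_modDl mod0n modn_small.
(* The number of steps from [ordS k] to [i] is i - (k + 1) modulo n; the subtraction written here
   never truncates. *)
move=> i; have -> : i = iter ((i + (n - k.+1)) %% n).+1 (@ordS n) k.
  apply: val_inj; rewrite val_iter_ordS addnS -addSn modnDmr addnCA.
  by rewrite subnKC // modnDr modn_small.
exact/Pt/ltn_pmod.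
Qed.

(** * Subgraphs and adjacency *)

Section Graph.

Variable G : mgraph.
Implicit Types (H K L C D : subgraph G) (x y z u v : vertex G).
Implicit Types (e f g h : edge G) (A B W : {set vertex G}).

Lemma subgraph_eq H K : vset H = vset K -> eset H = eset K -> H = K.
Proof.
case: H K => [A B p] [A' B' q] /= eqA eqB; move: p q; rewrite eqA eqB => p q.
by rewrite (bool_irrelevance p q).
Qed.

Lemma ends_neq e x y : ends e = [set x; y] -> x != y.
Proof. by move=> ee; have := card_ends e; rewrite ee cards2; case: (x != y). Qed.

Lemma ends_pair e : exists x y, ends e = [set x; y].
Proof.
by have /eqP/cards2P[x [y [_ ->]]] := card_ends e; exists x, y.
Qed.

Lemma ends_vset H e : e \in eset H -> ends e \subset vset H.
Proof. by move=> eH; apply: (forall_inP (ends_sub H)). Qed.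

Lemma ends_vsetP H e x y :
  e \in eset H -> ends e = [set x; y] -> x \in vset H /\ y \in vset H.
Proof.
by move=> /ends_vset + ee; rewrite ee subUset !sub1set => /andP[].
Qed.

Lemma adjP H x y :
  reflect (exists2 e, e \in eset H & ends e = [set x; y]) (adj H x y).
Proof.
apply: (iffP exists_inP) => -[e eH /eqP ee]; exists e => //; exact/eqP.
Qed.

Lemma adj_sym H : symmetric (adj H).
Proof. by move=> x y; apply: eq_existsb => e; rewrite setUC. Qed.

Lemma conn_sym H : connect_sym (adj H).
Proof. exact/sym_connect_sym/adj_sym. Qed.

Lemma conn_mono H K x y : eset H \subset eset K ->
  connect (adj H) x y -> connect (adj K) x y.
Proof.
move=> sHK; apply: connect_sub => {}x {}y /adjP[e eH ee].
by apply/connect1/adjP; exists e; rewrite ?(subsetP sHK).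
Qed.

Lemma connect_edge H e x y :
  e \in eset H -> ends e = [set x; y] -> connect (adj H) x y.
Proof. by move=> eH ee; apply/connect1/adjP; exists e. Qed.

Lemma in_eset_restrict A (B : {set edge G}) e :
  (e \in eset (restrict A B)) = (e \in B) && (ends e \subset A).
Proof. by rewrite inE. Qed.

Lemma restrict_id H : restrict (vset H) (eset H) = H.
Proof.
apply: subgraph_eq => //; apply/setP => e; rewrite in_eset_restrict.
by case: (boolP (e \in eset H)) => // /ends_vset.
Qed.

Lemma eset_del_edge H e : eset (del_edge H e) = eset H :\ e.
Proof.
apply/setP => h; rewrite in_eset_restrict andbC.
case: (boolP (h \in _ :\ _)); rewrite ?andbF // => /setD1P[_ /ends_vset ->].
by [].
Qed.

Lemma subgraph_le_trans K H L :
  subgraph_le H K -> subgraph_le K L -> subgraph_le H L.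
Proof.
by move=> /andP[v1 e1] /andP[v2 e2]; rewrite /subgraph_le !(subset_trans _ v2, subset_trans _ e2).
Qed.

(** * Edges across a vertex set *)

Definition crosses A e := ~~ (ends e \subset A) && ~~ (ends e \subset ~: A).

Lemma crossesE A e x y :
  ends e = [set x; y] -> crosses A e = ((x \in A) != (y \in A)).
Proof.
move=> ee; rewrite /crosses ee !subUset !sub1set !inE.
by case: (x \in A); case: (y \in A).
Qed.

(** Without an edge across [A], the set [A] would be closed under adjacency, hence under
    [connect]. *)
Lemma connect_crosses H A x y : connect (adj H) x y ->
  (x \in A) != (y \in A) -> exists2 e, e \in eset H & crosses A e.
Proof.
move=> cxy xyA; apply/exists_inP; apply: contraR xyA => /exists_inPn nc.
apply/eqP; apply: (closed_connect (a := mem A) _ cxy).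
move=> {cxy} {}x {}y /adjP[e eH ee].
by have := nc e eH; rewrite (crossesE _ ee) => /negPn/eqP.
Qed.

(** * Connected components *)

Lemma componentsE H :
  components H = [set [set y in vset H | connect (adj H) x y] | x in vset H].
Proof. by []. Qed.

(** Bounding the count by 1 admits the empty vertex set, which is left when the only vertex of a
    graph is deleted. *)
Lemma components_le1P H :
  reflect {in vset H &, forall x y, connect (adj H) x y} (#|components H| <= 1).
Proof.
apply: (iffP card_le1_eqP) => [eqC x y xH yH | cH P Q].
  have xC := imset_f (fun x => [set y in vset H | connect (adj H) x y]) xH.
  have yC := imset_f (fun x => [set y in vset H | connect (adj H) x y]) yH.
  by have /setP/(_ y) := eqC _ _ xC yC; rewrite !inE yH connect0.
rewrite componentsE => /imsetP[x xH ->] /imsetP[y yH ->].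
by apply/setP => z; rewrite !inE; case: (boolP (z \in _)) => //= zH; rewrite !cH.
Qed.

Lemma components_gt0 H : (0 < #|components H|) = (vset H != set0).
Proof. by rewrite card_gt0 componentsE imset_eq0. Qed.

Lemma connectedP H : connected H <->
  vset H != set0 /\ {in vset H &, forall x y, connect (adj H) x y}.
Proof.
rewrite /connected -components_gt0; split.
  by move=> c1; split; rewrite ?c1 //; apply/components_le1P; rewrite c1.
by case=> gt0 /components_le1P le1; apply/eqP; rewrite eqn_leq le1.
Qed.

Lemma eq_components H K : vset H = vset K ->
  (forall x y, connect (adj H) x y = connect (adj K) x y) ->
  components H = components K.
Proof.
move=> eqV eqc; rewrite !componentsE eqV; apply: eq_imset => x.
by apply/setP => y; rewrite !inE eqc.
Qed.

(** * Isthmuses *)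

Lemma connect_del_edge H e u v x y : ends e = [set u; v] ->
  connect (adj (del_edge H e)) u v ->
  connect (adj H) x y -> connect (adj (del_edge H e)) x y.
Proof.
move=> ee cuv; apply: connect_sub => {}x {}y /adjP[h hH eh].
case: (eqVneq h e) => [he | he]; last first.
  by apply: (connect_edge (e := h)); rewrite // eset_del_edge !inE he.
have xy := ends_neq eh; move: eh; rewrite he ee => /setP eq2.
have := eq2 x; have := eq2 y; have := eq2 u; have := eq2 v.
rewrite !inE !eqxx ?orbT /= => ev eu.
move=> /orP[]/eqP ey /orP[]/eqP ex; move: xy; rewrite ex ey ?eqxx //.
by rewrite conn_sym.
Qed.

(** Each component of [H] minus [e] lies in one of [H], which gives a surjection between the
    components. It identifies those of [u] and [v], so it is not injective when these differ. *)
Lemma isthmusP H e u v : e \in eset H -> ends e = [set u; v] ->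
  isthmus H e = ~~ connect (adj (del_edge H e)) u v.
Proof.
move=> eH ee; rewrite /isthmus eH /=; apply/idP/idP.
  apply: contraL => cuv; rewrite -leqNgt leq_eqVlt; apply/orP; left.
  rewrite (@eq_components (del_edge H e) H) // => x y; apply/idP/idP.
    by apply: conn_mono; rewrite eset_del_edge subD1set.
  exact: connect_del_edge cuv.
move=> ncuv; pose R := connect (adj H); pose R' := connect (adj (del_edge H e)).
have RR' x y : R' x y -> R x y.
  by apply: conn_mono; rewrite eset_del_edge subD1set.
pose F B := [set y in vset H | [exists x in B, R x y]].
have FE x : x \in vset H ->
    F [set y in vset H | R' x y] = [set y in vset H | R x y].
  move=> xH; apply/setP => y; rewrite !inE; case: (y \in _) => //=.
  apply/exists_inP/idP => [[z]|xy]; last first.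
    by exists x => //; rewrite inE xH; apply: connect0.
  by rewrite inE => /andP[_ /RR' xz]; apply: connect_trans.
have FC : F @: components (del_edge H e) = components H.
  rewrite !componentsE -imset_comp; apply: eq_in_imset => x xH.
  exact: FE.
rewrite ltn_neqAle -FC leq_imset_card andbT; apply/imset_injP => injF.
have [uH vH] := ends_vsetP eH ee.
have uC := imset_f (fun x => [set y in vset H | R' x y]) uH.
have vC := imset_f (fun x => [set y in vset H | R' x y]) vH.
have /setP/(_ v) : [set y in vset H | R' u y] = [set y in vset H | R' v y].
  apply: injF => //; rewrite !FE //; apply/setP => y; rewrite !inE.
  congr (_ && _); exact: (same_connect (@conn_sym H) (connect_edge eH ee)).
by rewrite !inE vH /R' connect0 (negbTE ncuv).
Qed.

(** [A] collects the vertices still joined to [u] after [e] is deleted; no other edge can leave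
    it. *)
Lemma isthmus_cut H e u v : isthmus H e -> ends e = [set u; v] ->
  exists A, [/\ u \in A, v \notin A
    & forall h, h \in eset H -> crosses A h -> h = e].
Proof.
move=> ie ee; have eH : e \in eset H by case/andP: ie.
rewrite (isthmusP eH ee) in ie.
exists [set y | connect (adj (del_edge H e)) u y]; split; rewrite ?inE //.
move=> h hH; apply: contraTeq => he.
have [x [y eh]] := ends_pair h; rewrite (crossesE _ eh) negbK !inE; apply/eqP.
apply: (same_connect_r (conn_sym _)); apply: (connect_edge _ eh).
by rewrite eset_del_edge !inE he.
Qed.

(** * Nonseparable subgraphs and blocks *)

Lemma in_eset_del_vertex H z e :
  (e \in eset (del_vertex H z)) = (e \in eset H) && (z \notin ends e).
Proof.
rewrite in_eset_restrict; case: (boolP (e \in _)) => //= /ends_vset sub.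
by rewrite subsetD1 sub.
Qed.

Lemma nonseparableP K : nonseparable K <->
  [/\ vset K != set0, {in vset K &, forall x y, connect (adj K) x y}
    & forall z, {in vset K :\ z &, forall x y, connect (adj (del_vertex K z)) x y}].
Proof.
split=> [[cK nK] | [K0 cK dK]].
  have /connectedP[K0 cxy] := cK; split=> // z.
  case: (boolP (z \in vset K)) => zK.
    apply/(components_le1P (del_vertex K z)).
    by have := nK z; rewrite /cut_vertex zK cK /= -leqNgt.
  move=> x y /setD1P[_ xK] /setD1P[_ yK].
  apply: conn_mono (cxy x y xK yK); apply/subsetP => e eK.
  by rewrite in_eset_del_vertex eK; apply: contra zK; apply/subsetP/ends_vset.
have c1 : connected K by apply/connectedP.
split=> // z; rewrite /cut_vertex c1 negb_and -leqNgt; apply/orP; right.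
exact/components_le1P/dK.
Qed.

(** Once [z] is deleted no edge crosses [A], yet the rest of [K] stays connected, so it lies on one
    side of [A]. *)
Lemma nonseparable_cut K A z x y : nonseparable K ->
  (forall e, e \in eset K -> crosses A e -> z \in ends e) ->
  x \in vset K -> y \in vset K -> x != z -> y != z -> (x \in A) = (y \in A).
Proof.
move=> /nonseparableP[_ _ dK] cr xK yK xz yz.
have /(connect_crosses (A := A)) c : connect (adj (del_vertex K z)) x y.
  by apply: dK; rewrite !inE ?xz ?yz.
apply/eqP/negPn/negP => /c[e]; rewrite in_eset_del_vertex => /andP[eK ze] eA.
by rewrite cr in ze.
Qed.

Fact union_subproof H K :
  [forall e in eset H :|: eset K, ends e \subset vset H :|: vset K].
Proof.
apply/forall_inP => e /setUP[]/ends_vset/subset_trans; apply.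
  exact: subsetUl.
exact: subsetUr.
Qed.

Definition union H K : subgraph G := Subgraph (union_subproof H K).

Lemma eset_unionl H K : eset H \subset eset (union H K).
Proof. exact: subsetUl. Qed.

Lemma eset_unionr H K : eset K \subset eset (union H K).
Proof. exact: subsetUr. Qed.

Lemma del_vertex_mono H K z : eset H \subset eset K ->
  eset (del_vertex H z) \subset eset (del_vertex K z).
Proof.
move=> /subsetP sHK; apply/subsetP => e; rewrite !in_eset_del_vertex.
by case/andP=> /sHK -> ->.
Qed.

(** Whichever vertex is deleted, one of [x], [y] survives and joins what is left of [H] to what is
    left of [K]. *)
Lemma nonseparable_union H K x y : nonseparable H -> nonseparable K ->
  x != y -> x \in vset H -> x \in vset K -> y \in vset H -> y \in vset K ->
  nonseparable (union H K).
Proof.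
move=> /nonseparableP[H0 cH dH] /nonseparableP[_ cK dK] xy xH xK yH yK.
apply/nonseparableP; split.
- by apply/set0Pn; exists x; rewrite !inE xH.
- have c a : a \in vset (union H K) -> connect (adj (union H K)) a x.
    case/setUP => aV; [apply: conn_mono (cH a x aV xH) | apply: conn_mono (cK a x aV xK)].
      exact: eset_unionl.
    exact: eset_unionr.
  by move=> a b /c ca /c; rewrite conn_sym; apply: connect_trans.
- move=> z; have [w [wz wH wK]] : exists w, [/\ w != z, w \in vset H & w \in vset K].
    case: (eqVneq x z) => [xz|xz]; last by exists x.
    by exists y; rewrite eq_sym -xz.
  have c a : a \in vset (union H K) :\ z ->
      connect (adj (del_vertex (union H K) z)) a w.
    case/setD1P => az /setUP[] aV.
      apply: (conn_mono (del_vertex_mono _ (eset_unionl H K))).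
      by apply: dH; rewrite !inE ?az ?wz.
    apply: (conn_mono (del_vertex_mono _ (eset_unionr H K))).
    by apply: dK; rewrite !inE ?az ?wz.
  by move=> a b /c ca /c; rewrite conn_sym; apply: connect_trans.
Qed.

(** A nonseparable subgraph of [H] around [L] with the most vertices plus edges is a block. The
    maximum runs over pairs of sets, a finite type; by [restrict_id] every subgraph comes from a
    pair. *)
Lemma block_exists H L : subgraph_le L H -> nonseparable L ->
  exists2 K, block H K & subgraph_le L K.
Proof.
move=> LH nL; pose R (p : {set vertex G} * {set edge G}) := restrict p.1 p.2.
pose P p := [&& subgraph_le (R p) H, #|components (R p)| == 1,
  [forall x, ~~ cut_vertex (R p) x] & subgraph_le L (R p)].
have PP K : subgraph_le K H -> nonseparable K -> subgraph_le L K ->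
    P (vset K, eset K).
  move=> KH [/eqP cK nK] LK; rewrite /P /R /= restrict_id KH LK cK andbT /=.
  exact/forallP.
have P0 : P (vset L, eset L) by apply: PP; rewrite // /subgraph_le !subxx.
pose m p := #|vset (R p)| + #|eset (R p)|.
case: (arg_maxnP m P0) => p /and4P[pH /eqP cp /forallP np Lp] maxp.
exists (R p) => //; split=> // L' L'H nL' /andP[sV sE].
have : m (vset L', eset L') <= m p.
  by apply/maxp/PP => //; apply: subgraph_le_trans Lp _; rewrite /subgraph_le sV.
rewrite {1}/m /R restrict_id -/R /m.
move=> le; have le1 := subset_leq_card sV; have le2 := subset_leq_card sE.
apply/esym/subgraph_eq; apply/eqP; rewrite eqEcard ?sV ?sE /=.
  by rewrite -(leq_add2r #|eset L'|) (leq_trans le) // leq_add2l.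
by rewrite -(leq_add2l #|vset L'|) (leq_trans le) // leq_add2r.
Qed.

(** * Circles *)

Lemma circle_del_edge C e : circle C -> e \in eset C ->
  {in vset C &, forall x y, connect (adj (del_edge C e)) x y}.
Proof.
case=> n [x [a [n1 injx inja ea [-> eE]]]]; rewrite eE => /imsetP[k _ ->].
(* The walk starts at the far end of the deleted edge and follows the others round to [x k]. *)
have c i : connect (adj (del_edge C (a k))) (x (ordS k)) (x i).
  elim/(ordS_ind (k := k)): i => [|i ik]; first exact: connect0.
  move=> /connect_trans; apply; apply: (connect_edge _ (ea i)).
  by rewrite eset_del_edge !inE (inj_eq inja) ik eE imset_f.
by move=> _ _ /imsetP[i _ ->] /imsetP[j _ ->]; apply: connect_trans (c j); rewrite conn_sym.
Qed.

Lemma circle_edge C : circle C -> exists e, e \in eset C.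
Proof.
case=> n [x [a [n1 _ _ _ [_ ->]]]].
by exists (a (Ordinal (ltnW n1))); apply: imset_f.
Qed.

Lemma circle_edge_neq C e : circle C -> exists2 h, h \in eset C & h != e.
Proof.
case=> n [x [a [n1 _ inja _ [_ ->]]]].
pose i0 := Ordinal (ltnW n1); pose i1 := Ordinal n1.
case: (eqVneq (a i0) e) => [<-|ne]; last by exists (a i0); rewrite ?imset_f.
by exists (a i1); rewrite ?imset_f // (inj_eq inja).
Qed.

Lemma circle_vertex C x : circle C -> x \in vset C ->
  exists2 e, e \in eset C & x \in ends e.
Proof.
case=> n [y [a [_ _ _ ea [-> ->]]]] /imsetP[i _ ->].
by exists (a i); rewrite ?imset_f // ea !inE eqxx.
Qed.

Lemma circle_le C H : circle C -> eset C \subset eset H -> subgraph_le C H.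
Proof.
move=> cC sCH; rewrite /subgraph_le sCH andbT; apply/subsetP => x.
by move=> /(circle_vertex cC)[e /(subsetP sCH)/ends_vset/subsetP]; apply.
Qed.

Lemma circle_nonseparable C : circle C -> nonseparable C.
Proof.
move=> cC; have [e eC] := circle_edge cC; have [u [v ee]] := ends_pair e.
have [uC vC] := ends_vsetP eC ee.
apply/nonseparableP; split; first by apply/set0Pn; exists u.
  move=> x y xC yC; apply: conn_mono (circle_del_edge cC eC xC yC).
  by rewrite eset_del_edge subD1set.
case: cC => n [x [a [n1 injx inja ea [eV eE]]]] z.
case: (boolP (z \in vset C)) => [|zC]; last first.
  move=> p q /setD1P[_ pC] /setD1P[_ qC].
  have cC : circle C by exists n, x, a.
  apply: conn_mono (circle_del_edge cC eC pC qC).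
  apply/subsetP => h; rewrite eset_del_edge in_eset_del_vertex => /setD1P[_ hC].
  by rewrite hC; apply: contra zC; apply/subsetP/ends_vset.
rewrite eV => /imsetP[k _ ->].
(* The deleted vertex [x k] is where the walk from [x (ordS k)] would end, so the first disjunct
   sets it apart. *)
have c i : i = k \/ connect (adj (del_vertex C (x k))) (x (ordS k)) (x i).
  elim/(ordS_ind (k := k)): i => [|i ik [ik'|ci]]; first by right; apply: connect0.
    by rewrite ik' eqxx in ik.
  case: (eqVneq (ordS i) k) => [|sik]; [by left | right].
  apply: connect_trans ci _; apply: (connect_edge _ (ea i)).
  rewrite in_eset_del_vertex eE imset_f //= ea !inE !(inj_eq injx).
  by rewrite ![k == _]eq_sym negb_or ik.
move=> p q /setD1P[pk /imsetP[i _ ep]] /setD1P[qk /imsetP[j _ eq]].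
move: pk qk; rewrite ep eq !(inj_eq injx); case: (c i) => [->|ci]; first by rewrite eqxx.
case: (c j) => [->|cj]; first by rewrite eqxx.
by move=> _ _; apply: connect_trans cj; rewrite conn_sym.
Qed.

(* C has a second edge at each vertex, so it contains the successor in D of
   each of its edges. *)
Lemma circle_le_eq C D : circle C -> circle D -> subgraph_le C D -> C = D.
Proof.
move=> cC cD /andP[sV sE]; have [n [x [a [n1 injx inja ea [eV eE]]]]] := cD.
have step k : a k \in eset C -> a (ordS k) \in eset C.
  move=> akC; have [xk xSk] := ends_vsetP akC (ea k).
  have [|h] := @connect_crosses _ [set x (ordS k)] _ _ (circle_del_edge cC akC xSk xk).
    by rewrite !inE eqxx (ends_neq (ea k)).
  rewrite eset_del_edge => /setD1P[hk hC].
  have := subsetP sE _ hC; rewrite eE => /imsetP[i _ hi].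
  rewrite hi (inj_eq inja) in hk; rewrite hi in hC *; rewrite (crossesE _ (ea i)) !inE !(inj_eq injx).
  (* The crossing edge [a i] has i = [ordS k] or [ordS i] = [ordS k]; the latter gives i = k, which
     is excluded. *)
  rewrite (inj_eq (can_inj (@ordSK n))) (negbTE hk).
  by case: (i =P ordS k) => // <-.
have [e eC] := circle_edge cC; have := subsetP sE _ eC.
rewrite eE => /imsetP[k _ ek]; have all_a i : a i \in eset C.
  elim/(ordS_ind (k := k)): i => [|i _]; last exact: step.
  by apply: step; rewrite -ek.
have DC : eset D \subset eset C by rewrite eE; apply/subsetP => _ /imsetP[i _ ->].
apply: subgraph_eq; apply/eqP; rewrite eqEsubset ?sV ?sE //.
by have /andP[] := circle_le cD DC.
Qed.

(** A simple path of [L] closed by [f] is the circle. If the path is a single edge, that edge is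
    parallel to [f], and [f \notin eset L] keeps the two distinct. *)
Lemma circle_through L f u v : ends f = [set u; v] -> f \notin eset L ->
  connect (adj L) u v ->
  exists C, [/\ circle C, f \in eset C & eset C \subset f |: eset L].
Proof.
move=> ef fL /connectP[p0 path0 last0]; have uv := ends_neq ef.
case: (shortenP path0) last0 => p pth unq _ lastv {p0 path0}.
pose n := (size p).+1; pose x (i : 'I_n) := nth u (u :: p) i.
(* Adjacency only asserts that an edge exists, so one is picked; the default [f] is never returned
   for adjacent vertices. *)
pose pick_edge s t := odflt f [pick e | (e \in eset L) && (ends e == [set s; t])].
have pickP s t : adj L s t ->
    pick_edge s t \in eset L /\ ends (pick_edge s t) = [set s; t].
  move=> /adjP[e eL ee]; rewrite /pick_edge; case: pickP => [h /andP[hL /eqP]//|].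
  by move=> /(_ e); rewrite eL ee eqxx.
(* Index [size p] carries the closing edge from [v] back to [u]. *)
pose a (i : 'I_n) := if i < size p then pick_edge (nth u (u :: p) i) (nth u (u :: p) i.+1) else f.
have aP (i : 'I_n) : i < size p ->
    a i \in eset L /\ ends (a i) = [set nth u (u :: p) i; nth u (u :: p) i.+1].
  by move=> lt; rewrite /a lt; apply: pickP; have /pathP := pth; apply.
have injx : injective x.
  move=> i j /eqP; rewrite /x nth_uniq //= => /eqP; exact: val_inj.
have p0 : 0 < size p by case: (p) lastv uv => //= ->; rewrite eqxx.
have ea i : ends (a i) = [set x i; x (ordS i)].
  case: (ltnP i (size p)) => ip.
    by have [_ ->] := aP i ip; rewrite /x /= modn_small.
  have ei : (i : nat) = size p by apply/eqP; rewrite eqn_leq ip -ltnS ltn_ord.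
  by rewrite /a /x /= ei ltnn modnn ef lastv (last_nth u) setUC.
have aL (i : 'I_n) : i < size p -> a i \in eset L by move=> /aP[].
have inja : injective a.
  move=> i j aij; case: (ltnP i (size p)) (ltnP j (size p)) => ip [] jp.
  - have [_ e1] := aP i ip; have [_ e2] := aP j jp.
    (* On a simple path {i, i+1} = {j, j+1} forces i = j, so the path edges are told apart by their
       ends. *)
    have /setP eq2 : [set nth u (u :: p) i; nth u (u :: p) i.+1] =
        [set nth u (u :: p) j; nth u (u :: p) j.+1] by rewrite -e1 -e2 aij.
    have := eq2 (nth u (u :: p) i); have := eq2 (nth u (u :: p) i.+1).
    have := eq2 (nth u (u :: p) j).
    rewrite !inE !eqxx !nth_uniq // ?ltnS //= 1?ltnW //.
    rewrite orbT eqSS /= => /esym e3 e4 e5.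
    apply: val_inj => /=; move: e3 e4 e5; lia.
  - by move: fL; have := aL i ip; rewrite aij /a ltnNge jp /= => ->.
  - by move: fL; have := aL j jp; rewrite -aij /a ltnNge ip /= => ->.
  - by apply: val_inj; apply/eqP; rewrite /= eqn_leq
      (leq_trans _ jp) ?(leq_trans _ ip) // -ltnS ltn_ord.
have sub : [forall e in [set a i | i : 'I_n], ends e \subset [set x i | i : 'I_n]].
  apply/forall_inP => _ /imsetP[i _ ->]; rewrite ea subUset !sub1set.
  by rewrite !imset_f.
exists (Subgraph sub); split=> /=.
- by exists n, x, a; split.
- by apply/imsetP; exists ord_max; rewrite // /a ltnn.
- apply/subsetP => _ /imsetP[i _ ->]; rewrite !inE.
  by case: (ltnP i (size p)) => ip; [rewrite aL ?orbT | rewrite /a ltnNge ip eqxx].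
Qed.

(* A block growing out of C would be attached at a single vertex of C, which
   would then be a cut vertex. *)
Lemma nonseparable_circle_eq K C : nonseparable K -> circle C ->
  subgraph_le C K ->
  (forall x y, x \in vset C -> y \in vset C -> x != y ->
     exists2 A : {set vertex G}, (x \in A) != (y \in A)
       & forall e, e \in eset K -> crosses A e -> e \in eset C) ->
  K = C.
Proof.
move=> nK cC /andP[sV sE] sep.
have [e0 e0C] := circle_edge cC; have [c1 [c2 ee0]] := ends_pair e0.
have [c1C c2C] := ends_vsetP e0C ee0; have c12 := ends_neq ee0.
(* Given this, a vertex of [K] off [C] could not be joined to [C], against the connectedness of
   [K]. *)
suff KC : eset K \subset eset C.
  apply: subgraph_eq; apply/eqP; rewrite eqEsubset ?sV ?sE ?KC // andbT.
  apply/subsetP => x xK; have /nonseparableP[_ cK _] := nK.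
  apply: contraT => xC; have := cK c1 x (subsetP sV _ c1C) xK.
  move=> /(connect_crosses (A := vset C)); rewrite c1C (negbTE xC) => -[//|e eK].
  by rewrite /crosses ends_vset // (subsetP KC).
apply/subsetP => h hK; apply: contraT => hC.
have [p [q eh]] := ends_pair h; have pq := ends_neq eh.
have [pK qK] := ends_vsetP hK eh.
(* [L] is [K] without the edges of [C], and [W] below is the component of [L] that holds [h]. It
   meets [C] at most once: two common vertices would be joined in [L] across a cut given by
   [sep]. *)
pose L := restrict (vset K) (eset K :\: eset C).
have inL e : (e \in eset L) = (e \in eset K) && (e \notin eset C).
  rewrite in_eset_restrict !inE; case: (boolP (e \in eset K)) => [|_]; last by rewrite andbF.
  by move=> /ends_vset ->; rewrite !andbT.
pose W := [set y | connect (adj L) p y].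
have pW : p \in W by rewrite inE connect0.
have qW : q \in W by rewrite inE; apply: (connect_edge _ eh); rewrite inL hK.
have crW e : e \in eset K -> crosses W e -> e \in eset C.
  move=> eK; apply: contraTT => eC; have [x [y ee]] := ends_pair e.
  rewrite (crossesE _ ee) negbK !inE; apply/eqP.
  by apply: (same_connect_r (conn_sym _)); apply: (connect_edge _ ee); rewrite inL eK.
have WC x y : x \in W -> y \in W -> x \in vset C -> y \in vset C -> x = y.
  rewrite !inE => px py xC yC; apply/eqP; apply: contraT => xy.
  have [A Axy crA] := sep x y xC yC xy.
  have cxy : connect (adj L) x y by apply: connect_trans py; rewrite conn_sym.
  have [e] := connect_crosses cxy Axy; rewrite inL => /andP[eK /negP eC] /(crA _ eK).
  by move=> /eC.
(* If [W] misses [C], any vertex serves as [z]. *)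
have [z zP] : exists z, forall x, x \in W -> x \in vset C -> x = z.
  case: (set_0Vmem (W :&: vset C)) => [W0 | [z /setIP[zW zC]]].
    by exists q => x xW xC; move/setP/(_ x): W0; rewrite in_setI xW xC inE.
  by exists z => x xW xC; apply: WC.
have crz e : e \in eset K -> crosses W e -> z \in ends e.
  move=> eK eW; have eC := crW e eK eW.
  have [x [y ee]] := ends_pair e; have [xC yC] := ends_vsetP eC ee.
  move: eW; rewrite (crossesE _ ee) ee in_set2.
  case: (boolP (x \in W)) => [/zP/(_ xC) -> |_]; first by rewrite eqxx.
  by case: (boolP (y \in W)) => [/zP/(_ yC) -> | _]; rewrite ?eqxx ?orbT.
(* [W] contains both ends of [h] and [C] those of [e0], so each has a vertex other than [z]. These
   lie on opposite sides of [W], while every edge of [K] across [W] meets [z]. *)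
have [r rW [rz rK]] : exists2 r, r \in W & r != z /\ r \in vset K.
  case: (eqVneq p z) => [<-|pz]; last by exists p.
  by exists q; rewrite // eq_sym.
have [y yC yz] : exists2 y, y \in vset C & y != z.
  case: (eqVneq c1 z) => [<-|?]; last by exists c1.
  by exists c2; rewrite // eq_sym.
have := nonseparable_cut nK crz rK (subsetP sV _ yC) rz yz.
by rewrite rW => /esym/zP/(_ yC) yz'; rewrite yz' eqxx in yz.
Qed.

(** By [nonseparable_cut] at [u], a third vertex is on the side of [v]; by the same at [v], it is on
    the side of [u]. But [e] crosses [A]. An edge parallel to [e] would cross [A] too. *)
Lemma nonseparable_isthmus K A e : nonseparable K -> e \in eset K ->
  crosses A e -> (forall h, h \in eset K -> crosses A h -> h = e) ->
  vset K = ends e /\ eset K = [set e].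
Proof.
move=> nK eK eA cr; have [u [v ee]] := ends_pair e.
have [uK vK] := ends_vsetP eK ee; have uv := ends_neq ee.
have Auv : (u \in A) != (v \in A) by rewrite -(crossesE _ ee).
have eV : vset K = ends e.
  apply/eqP; rewrite eqEsubset ends_vset // andbT; apply/subsetP => x xK.
  rewrite ee !inE; apply: contraT; rewrite negb_or => /andP[xu xv].
  have xA := @nonseparable_cut K A u x v nK _ xK vK xu _.
  have xA' := @nonseparable_cut K A v x u nK _ xK uK xv _.
  move: Auv; rewrite -xA' ?xA ?eqxx // 1?eq_sym //.
    by move=> h hK /(cr h hK) ->; rewrite ee !inE eqxx.
  by move=> h hK /(cr h hK) ->; rewrite ee !inE eqxx orbT.
split=> //; apply/setP => h; rewrite inE; apply/idP/eqP => [hK | ->//].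
apply: cr => //; have : ends h = ends e.
  by apply/eqP; rewrite eqEcard !card_ends leqnn andbT -eV ends_vset.
by move: eA; rewrite /crosses => + ->.
Qed.

Lemma component_ofE H x y : x \in vset H -> y \in vset H ->
  (component_of H x == component_of H y) = connect (adj H) x y.
Proof.
move=> xH yH; have eqv : {in vset H & &, equivalence_rel (connect (adj H))}.
  move=> a b c _ _ _; split; first exact: connect0.
  by move=> ab; apply: (same_connect (@conn_sym H)).
have /and3P[/eqP cov triv _] := equivalence_partitionP eqv.
by rewrite eq_pblock ?cov // (pblock_equivalence_partition eqv).
Qed.

(** This turns disjointness of distinct circles into equality of circles that share an edge. *)
Lemma subgraph_eq_dec H K : H = K \/ H <> K.
Proof.
case: (eqVneq (vset H) (vset K)) => [eqV | neV]; last first.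
  by right=> eqH; rewrite eqH eqxx in neV.
case: (eqVneq (eset H) (eset K)) => [eqE | neE]; last first.
  by right=> eqH; rewrite eqH eqxx in neE.
by left; apply: subgraph_eq.
Qed.

(** [C] minus [h] still joins the ends of [h], so it crosses [A] as well. *)
Lemma circle_crosses C h A : circle C -> h \in eset C -> crosses A h ->
  exists2 h', h' \in eset C & h' != h /\ crosses A h'.
Proof.
move=> cC hC; have [u [v eh]] := ends_pair h; rewrite (crossesE _ eh) => uvA.
have [uC vC] := ends_vsetP hC eh.
have [h'] := connect_crosses (circle_del_edge cC hC uC vC) uvA.
by rewrite eset_del_edge => /setD1P[h'h h'C] h'A; exists h'.
Qed.

End Graph.

(** * The isthmus forest and its cuts *)

Section Signed.

Variable S : signed_graph.
Implicit Types (L C : subgraph S) (x y u v : vertex S) (e f g h : edge S).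
Implicit Types (A T : {set vertex S}).

Notation P := (positive_subgraph S).
Notation F := (isthmus_forest S).

Lemma in_positive e : (e \in eset P) = ~~ negative e.
Proof. by rewrite in_eset_restrict subsetT andbT !inE. Qed.

Lemma in_forest e : (e \in eset F) = isthmus P e.
Proof. by rewrite in_eset_restrict subsetT andbT inE. Qed.

Lemma forest_positive e : e \in eset F -> ~~ negative e.
Proof. by rewrite in_forest => /andP[+ _]; rewrite in_positive. Qed.

Lemma in_tree T e : (e \in eset (tree_with_negative_edges T)) =
  ((e \in eset F) || negative e) && (ends e \subset T).
Proof. by rewrite in_eset_restrict in_setU [e \in negative_edges S]inE. Qed.

(** Negative edges may cross [A] freely: this is what the cut of an isthmus of the positive subgraph
    becomes in the whole signed graph. *)
Definition positive_cut A g := forall h, ~~ negative h -> crosses A h -> h = g.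

Lemma forest_edge_cut g u v : g \in eset F -> ends g = [set u; v] ->
  exists A, [/\ u \in A, v \notin A & positive_cut A g].
Proof.
rewrite in_forest => ig eg; have [A [uA vA cA]] := isthmus_cut ig eg.
by exists A; split=> // h hpos; apply: cA; rewrite in_positive.
Qed.

(* The cut belongs to the first edge of a simple path from x to y: the rest of
   the path avoids x, hence that edge. *)
Lemma forest_cut L x y : eset L \subset eset F -> connect (adj L) x y -> x != y ->
  exists A g, [/\ g \in eset L, (x \in A) != (y \in A) & positive_cut A g].
Proof.
move=> LF /connectP[p0 path0 last0] xy.
case: (shortenP path0) last0 => {p0 path0} [[|x1 p]] pth unq _ /= lasty.
  by rewrite lasty eqxx in xy.
move: pth unq => /= /andP[/adjP[g gL eg] pth] /andP[xp _].
have [A [xA x1A cA]] := forest_edge_cut (subsetP LF _ gL) eg.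
exists A, g; split=> //; rewrite xA; apply/negP => /eqP/esym yA.
have : connect (adj (del_vertex L x)) x1 y.
  apply/connectP; exists p => //.
  have sub : {in predC1 x &, subrel (adj L) (adj (del_vertex L x))}.
    move=> a b; rewrite !inE => ax bx /adjP[h hL eh]; apply/adjP; exists h => //.
    by rewrite in_eset_del_vertex hL eh !inE negb_or ![x == _]eq_sym ax.
  apply: (sub_in_path sub _ pth); apply/allP => z zp; apply: contra xp.
  by move=> /eqP <-.
move=> /(connect_crosses (A := A)); rewrite yA (negbTE x1A) => -[//|h].
rewrite in_eset_del_vertex => /andP[hL xh] hA.
have hg := cA h (forest_positive (subsetP LF _ hL)) hA.
by rewrite hg eg !inE eqxx in xh.
Qed.

(** * Weakly negative circles *)

Lemma weakly_negativeP C : weakly_negative C <->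
  exists f, [/\ f \in eset C, negative f
    & forall h, h \in eset C -> negative h -> h = f].
Proof.
rewrite /weakly_negative; split=> [/eqP/cards1P[f eqf] | [f [fC nf uf]]].
  have /setP/(_ f) := eqf; rewrite !inE eqxx => /andP[fC nf].
  exists f; split=> // h hC nh; have /setP/(_ h) := eqf.
  by rewrite !inE hC nh => /esym/eqP.
apply/eqP/cards1P; exists f; apply/setP => h; rewrite !inE.
by apply/andP/eqP => [[]|->]; [apply: uf|].
Qed.

Lemma weakly_negative_circle_through L f u v :
  negative f -> ends f = [set u; v] ->
  {in eset L, forall h, ~~ negative h} -> connect (adj L) u v ->
  exists C, [/\ circle C, weakly_negative C, f \in eset C
    & eset C \subset f |: eset L].
Proof.
move=> nf ef Lpos cuv; have fL : f \notin eset L by apply: contraL nf => /Lpos.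
have [C [cC fC sC]] := circle_through ef fL cuv; exists C; split=> //.
apply/weakly_negativeP; exists f; split=> // h /(subsetP sC)/setU1P[->//|hL].
by rewrite (negbTE (Lpos h hL)).
Qed.

(** [C] crosses [A] a second time. As [f] is its only negative edge, the second crossing is positive
    and can only be [g]. *)
Lemma weakly_negative_cut C f A g : circle C -> weakly_negative C ->
  f \in eset C -> negative f -> positive_cut A g -> crosses A f ->
  g \in eset C.
Proof.
move=> cC /weakly_negativeP[f0 [_ _ uf]] fC nf cA fA.
have [h hC [hf hA]] := circle_crosses cC fC fA.
rewrite -(cA h) //; apply: contra hf => nh.
by rewrite (uf h hC nh) (uf f fC nf).
Qed.

(** * Trees of the isthmus forest *)

Lemma tree_connect T x y : T \in components F -> x \in T -> y \in T ->
  connect (adj (restrict T (eset F))) x y.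
Proof.
rewrite componentsE => /imsetP[t _ ->]; set T' := [set _ in _ | _].
have inT z : (z \in T') = connect (adj F) t z by rewrite !inE.
rewrite !inT => tx ty; set L := restrict _ _.
have LF : eset L \subset eset F.
  by apply/subsetP => e; rewrite in_eset_restrict => /andP[].
have cxy : connect (adj F) x y by apply: connect_trans ty; rewrite conn_sym.
(* [W] is what is reached from [x] inside [T']. An edge of the forest has both ends in [T'], so
   belongs to [L], or neither, so misses [W]; in no case does it cross [W]. *)
pose W := [set z | connect (adj L) x z].
suff : ~~ ((x \in W) != (y \in W)) by rewrite !inE connect0 negbK => /eqP.
apply/negP => /(connect_crosses cxy)[e eF].
have [a [b ee]] := ends_pair e; rewrite (crossesE _ ee) => /negP[]; rewrite !inE.
case: (boolP (e \in eset L)) => [eL|].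
  by apply/eqP/(same_connect_r (@conn_sym _ L))/(connect_edge eL).
have TL z : connect (adj L) x z -> z \in T'.
  by rewrite inT => /(conn_mono LF); apply: connect_trans.
have abT : (a \in T') = (b \in T').
  by rewrite !inT; apply/(same_connect_r (@conn_sym _ F))/(connect_edge eF).
rewrite in_eset_restrict eF /= ee subUset !sub1set -abT andbb => aT.
by apply/eqP; apply/idP/idP => /TL; rewrite -?abT (negbTE aT).
Qed.

Lemma component_nonempty T : T \in components F -> exists x, x \in T.
Proof.
rewrite componentsE => /imsetP[t _ ->]; exists t; rewrite !inE; exact: connect0.
Qed.

(** The path of [T] between the ends of [f] consists of isthmuses, hence of positive edges, and
    closes up with [f]. *)
Lemma tree_circle T f : T \in components F -> negative f -> ends f \subset T ->
  exists C, [/\ circle C, weakly_negative C, f \in eset C,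
    eset C \subset f |: eset F & subgraph_le C (tree_with_negative_edges T)].
Proof.
move=> TF nf fT; have [u [v ef]] := ends_pair f.
have /andP[uT vT] : (u \in T) && (v \in T) by rewrite -!sub1set -subUset -ef.
have [|C [cC wC fC sC]] :=
    weakly_negative_circle_through nf ef _ (tree_connect TF uT vT).
  by move=> h; rewrite in_eset_restrict => /andP[/forest_positive].
exists C; split=> //.
  apply: subset_trans sC _; apply: setUS; apply/subsetP => h.
  by rewrite in_eset_restrict => /andP[].
apply: circle_le => //; apply/subsetP => h /(subsetP sC)/setU1P[->|].
  by rewrite in_tree nf orbT.
by rewrite in_eset_restrict in_tree => /andP[-> ->].
Qed.

(** * From disjoint circles to the conditions on the forest *)

Definition weakly_negative_circles_disjoint := forall C1 C2 : subgraph S,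
  circle C1 -> weakly_negative C1 -> circle C2 -> weakly_negative C2 ->
  C1 <> C2 -> [disjoint eset C1 & eset C2].

Lemma disjoint_circles_eq C1 C2 e : weakly_negative_circles_disjoint ->
  circle C1 -> weakly_negative C1 -> circle C2 -> weakly_negative C2 ->
  e \in eset C1 -> e \in eset C2 -> C1 = C2.
Proof.
move=> dis c1 w1 c2 w2 e1 e2; case: (subgraph_eq_dec C1 C2) => // ne.
by have /pred0P/(_ e) := dis _ _ c1 w1 c2 w2 ne; rewrite /= e1 e2.
Qed.

(** Let [C] be closed by [e] and a positive path. If a positive edge [g] of [C] were no isthmus, [u]
    and [v] would stay joined without [g], and [e] would lie on a second weakly negative circle, one
    that avoids [g]. So [C] minus [e] lies in the forest. *)
Lemma disjoint_circles_ends e u v : weakly_negative_circles_disjoint ->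
  negative e -> ends e = [set u; v] -> connect (adj P) u v ->
  connect (adj F) u v.
Proof.
move=> dis ne ee cuv.
have Ppos : {in eset P, forall h, ~~ negative h} by move=> h; rewrite in_positive.
have [C [cC wC eC sC]] := weakly_negative_circle_through ne ee Ppos cuv.
have [uC vC] := ends_vsetP eC ee.
case: (boolP (eset C :\ e \subset eset F)) => [sCF | /subsetPn[g]].
  by apply: conn_mono (circle_del_edge cC eC uC vC); rewrite eset_del_edge.
case/setD1P=> ge gC; rewrite in_forest.
have gP : g \in eset P by have := subsetP sC g gC; rewrite !inE (negbTE ge).
have [a [b eg]] := ends_pair g; rewrite (isthmusP gP eg) negbK => cab.
have [|C' [cC' wC' eC' sC']] := weakly_negative_circle_through
    ne ee _ (connect_del_edge eg cab cuv).
  by move=> h; rewrite eset_del_edge => /setD1P[_ /Ppos].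
have eqC := disjoint_circles_eq dis cC wC cC' wC' eC eC'.
have := subsetP sC' g; rewrite -eqC gC eset_del_edge !inE (negbTE ge) eqxx /=.
by move=> /(_ isT).
Qed.

Lemma tree_connected T : T \in components F ->
  connected (tree_with_negative_edges T).
Proof.
move=> TF; apply/connectedP; split.
  by apply/set0Pn; apply: component_nonempty.
move=> x y xT yT; apply: conn_mono (tree_connect TF xT yT); apply/subsetP => e.
by rewrite in_eset_restrict in_tree => /andP[-> ->].
Qed.

Lemma disjoint_circles_cactus T : weakly_negative_circles_disjoint ->
  T \in components F -> cactus (tree_with_negative_edges T).
Proof.
move=> dis TF; split; first exact: tree_connected.
move=> K [KH nK maxK]; set H := tree_with_negative_edges T in KH maxK *.
have /nonseparableP[K0 cK _] := nK.
case: (set_0Vmem (eset K)) => [E0 | [e eK]].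
  apply: Or33; case/set0Pn: K0 => x xK; apply/eqP/cards1P; exists x.
  apply/setP => y; rewrite inE; apply/idP/eqP => [yK|->//]; apply/eqP.
  apply: contraT => yx; have := cK x y xK yK.
  move/(connect_crosses (A := [set x])); rewrite !inE eqxx (negbTE yx).
  by case=> // e; rewrite E0 inE.
have /subsetP sKH : eset K \subset eset H by case/andP: KH.
have negT h : h \in eset H -> negative h -> ends h \subset T.
  by rewrite in_tree => /andP[].
(* Either [e] lies on a circle closing some negative edge [f] through the forest, or [e] is alone in
   a cut of [H]. *)
have [[f [C [[nf fC cC wC] CF CH eC]]] | [A eA cA]] :
    (exists f C, [/\ [/\ negative f, f \in eset C, circle C & weakly_negative C],
       eset C \subset f |: eset F, subgraph_le C H & e \in eset C]) \/
    (exists2 A, crosses A e & forall h, h \in eset H -> crosses A h -> h = e).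
  have circ f : f \in eset H -> negative f ->
      exists C, [/\ [/\ negative f, f \in eset C, circle C & weakly_negative C],
        eset C \subset f |: eset F & subgraph_le C H].
    by move=> fH nf; have [C []] := tree_circle TF nf (negT f fH nf); exists C.
  have eH := sKH e eK; case: (boolP (negative e)) => [ne | pe].
    by left; have [C [C1 C2 C3]] := circ e eH ne; exists e, C; split=> //; case: C1.
  have eF : e \in eset F by move: eH; rewrite in_tree (negbTE pe) orbF => /andP[].
  have [u [v ee]] := ends_pair e; have [A [uA vA cA]] := forest_edge_cut eF ee.
  have eA : crosses A e by rewrite (crossesE _ ee) uA (negbTE vA).
  (* A further edge [h] of [H] across [A] must be negative, and the circle closing it through the
     tree then contains [e]. *)
  case: (boolP [exists h in eset H, crosses A h && (h != e)]).
    case/exists_inP => h hH /andP[hA he]; left.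
    have nh : negative h by apply: contraNT he => ph; rewrite (cA h ph hA).
    have [C [C1 C2 C3]] := circ h hH nh; exists h, C; split=> //.
    by case: C1 => _ hC cC wC; apply: weakly_negative_cut cA hA.
  move/exists_inPn=> no; right; exists A => // h hH hA; apply/eqP.
  by have := no h hH; rewrite hA /= negbK.
- apply: Or31; suff -> : K = C by [].
  have [u [v ee]] := ends_pair e; have [uC vC] := ends_vsetP eC ee.
  have [uK vK] := ends_vsetP eK ee.
  (* [K] and [C] share the ends of [e], so maximality of [K] absorbs [C]. *)
  have nU := nonseparable_union nK (circle_nonseparable cC) (ends_neq ee) uK uC vK vC.
  have UK : union K C = K.
    apply: maxK => //; case/andP: KH => KV KE; case/andP: CH => CV CE.
      by apply/andP; rewrite !subUset KV CV KE.
    by apply/andP; rewrite !subsetUl.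
  have CK : subgraph_le C K by rewrite -UK; apply/andP; rewrite !subsetUr.
  (* [C] minus [f] consists of isthmuses, so some [g] in it has a cut separating [x] from [y]. A
     negative edge of [K] across that cut lies on a weakly negative circle through [g], which by
     disjointness is [C]. *)
  apply: nonseparable_circle_eq => // x y xC yC xy.
  have [|A [g [gL xyA cA]]] :=
      forest_cut _ (circle_del_edge cC fC xC yC) xy.
    by rewrite eset_del_edge subDset.
  exists A => // h hK hA; have gC : g \in eset C.
    by move: gL; rewrite eset_del_edge => /setD1P[].
  case: (boolP (negative h)) => [nh | ph]; last by rewrite (cA h ph hA).
  have [C' [cC' wC' hC' _ _]] := tree_circle TF nh (negT h (sKH h hK) nh).
  have gC' := weakly_negative_cut cC' wC' hC' nh cA hA.
  by rewrite (disjoint_circles_eq dis cC wC cC' wC' gC gC').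
- have [] := nonseparable_isthmus nK eK eA (fun h hK => cA h (sKH h hK)).
  move=> eV eE; apply: Or32; exists e; split=> //.
  have [u [v ee]] := ends_pair e; rewrite (isthmusP (sKH e eK) ee).
  apply/negP => /(connect_crosses (A := A)); rewrite -(crossesE _ ee) => -[//|h].
  by rewrite eset_del_edge => /setD1P[he hH] /(cA h hH) eqh; rewrite eqh eqxx in he.
Qed.

(** * From the conditions on the forest to disjoint circles *)

Lemma weakly_negative_circle_in_tree C :
  (forall e u v, negative e -> ends e = [set u; v] ->
     connect (adj P) u v -> connect (adj F) u v) ->
  circle C -> weakly_negative C ->
  exists2 T, T \in components F & subgraph_le C (tree_with_negative_edges T).
Proof.
move=> hF cC wC; have [f [fC nf uf]] := (weakly_negativeP C).1 wC.
have [u [v ef]] := ends_pair f; have [uC vC] := ends_vsetP fC ef.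
have cuv : connect (adj F) u v.
  apply: (hF f) => //; apply: conn_mono (circle_del_edge cC fC uC vC).
  apply/subsetP => h; rewrite eset_del_edge in_positive => /setD1P[hf hC].
  by apply: contra hf => /(uf h hC) ->.
pose T := [set y in vset F | connect (adj F) u y].
have TF : T \in components F by apply: imset_f; rewrite inE.
have fT : ends f \subset T.
  by rewrite ef subUset !sub1set !inE cuv connect0.
have [C' [cC' wC' fC' C'F C'T]] := tree_circle TF nf fT.
exists T => //; suff <- : C' = C by [].
apply: circle_le_eq => //; apply: circle_le => //; apply/subsetP => g gC'.
have /setU1P[->//|gF] := subsetP C'F g gC'.
have [a [b eg]] := ends_pair g; have [A [aA bA cA]] := forest_edge_cut gF eg.
have gA : crosses A g by rewrite (crossesE _ eg) aA (negbTE bA).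
(* [C'] crosses the cut of [g] again. Its edges other than [f] are in the forest, hence positive, so
   this crossing is [f] itself; then [C] also has to use [g]. *)
have [h hC' [hg hA]] := circle_crosses cC' gC' gA.
apply: (weakly_negative_cut cC wC fC nf cA).
have /setU1P[<-//|/forest_positive/cA/(_ hA) eqh] := subsetP C'F h hC'.
by rewrite eqh eqxx in hg.
Qed.

Lemma components_eq T1 T2 x : T1 \in components F -> T2 \in components F ->
  x \in T1 -> x \in T2 -> T1 = T2.
Proof.
rewrite componentsE => /imsetP[t _ ->] /imsetP[s _ ->]; rewrite !inE /=.
move=> tx sx; apply/setP => y; rewrite !inE /=.
have sym := @conn_sym _ F.
by rewrite (same_connect sym tx) (same_connect sym sx).
Qed.

(** [C] and [D] share the ends of [e], so their union lies in one block. Having two edges and two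
    vertices, it fits neither an isthmus nor a single vertex; the block is a circle, equal to both
    by [circle_le_eq]. *)
Lemma cactus_circles_eq (H C D : subgraph S) e : cactus H ->
  circle C -> circle D -> subgraph_le C H -> subgraph_le D H ->
  e \in eset C -> e \in eset D -> C = D.
Proof.
move=> [_ cactH] cC cD CH DH eC eD.
have [u [v ee]] := ends_pair e; have [uC vC] := ends_vsetP eC ee.
have [uD vD] := ends_vsetP eD ee.
have nU := nonseparable_union (circle_nonseparable cC) (circle_nonseparable cD)
  (ends_neq ee) uC uD vC vD.
have UH : subgraph_le (union C D) H.
  case/andP: CH => CV CE; case/andP: DH => DV DE.
  by apply/andP; rewrite !subUset CV DV CE.
have [K bK UK] := block_exists UH nU.
have CK : subgraph_le C K.
  by apply: subgraph_le_trans UK; apply/andP; rewrite !subsetUl.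
have DK : subgraph_le D K.
  by apply: subgraph_le_trans UK; apply/andP; rewrite !subsetUr.
case: (cactH K bK) => [cK | [g [_ _ eE]] | K1].
- by rewrite (circle_le_eq cC cK CK) (circle_le_eq cD cK DK).
- have [h hC hg] := circle_edge_neq g cC; case/andP: CK => _ /subsetP/(_ h hC).
  by rewrite eE inE (negbTE hg).
- case/andP: CK => /subsetP sV _; have uv := ends_neq ee.
  have /card_le1_eqP/(_ u v (sV u uC) (sV v vC)) uv' : #|vset K| <= 1 by rewrite K1.
  by rewrite uv' eqxx in uv.
Qed.

End Signed.

Theorem mainTheorem3 (S : signed_graph) :
  (forall C1 C2 : subgraph S,
      circle C1 -> weakly_negative C1 ->
      circle C2 -> weakly_negative C2 ->
      C1 <> C2 -> [disjoint eset C1 & eset C2])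
  <->
  ((forall (e : edge S) (u v : vertex S),
       negative e -> ends e = [set u; v] ->
       component_of (positive_subgraph S) u
         <> component_of (positive_subgraph S) v
       \/ component_of (isthmus_forest S) u
         = component_of (isthmus_forest S) v)
   /\
   (forall T : {set vertex S},
       T \in components (isthmus_forest S) ->
       cactus (tree_with_negative_edges T))).
Proof.
(* Both the positive subgraph and the forest span all vertices, so (a) can be read in terms of
   [connect]. *)
have compE (H : subgraph S) u v : vset H = setT ->
    component_of H u = component_of H v <-> connect (adj H) u v.
  move=> HT; rewrite -component_ofE ?HT ?inE //; split; first by move->.
  by move/eqP.
split=> [dis | [ha hb]].
  split=> [e u v ne ee | T TF]; last exact: disjoint_circles_cactus.
  case: (component_of (positive_subgraph S) u
           =P component_of (positive_subgraph S) v) => [/compE cuv|]; last by left.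
  by right; apply/compE => //; apply: (disjoint_circles_ends dis ne ee); apply: cuv.
have hF e u v : negative e -> ends e = [set u; v] ->
    connect (adj (positive_subgraph S)) u v ->
    connect (adj (isthmus_forest S)) u v.
  by move=> ne ee /compE-/(_ erefl) cuv; case: (ha e u v ne ee) => // /compE; apply.
move=> C1 C2 c1 w1 c2 w2 ne; apply/pred0P => e /=; apply/negP => /andP[e1 e2].
have [T1 T1F C1T] := weakly_negative_circle_in_tree hF c1 w1.
have [T2 T2F C2T] := weakly_negative_circle_in_tree hF c2 w2.
have [u [v ee]] := ends_pair e; have [u1 _] := ends_vsetP e1 ee.
have [u2 _] := ends_vsetP e2 ee.
have /andP[/subsetP/(_ u u1) uT1 _] := C1T.
have /andP[/subsetP/(_ u u2) uT2 _] := C2T.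
have eqT := components_eq T1F T2F uT1 uT2; rewrite -eqT in C2T.
exact/ne/(cactus_circles_eq (hb T1 T1F) c1 c2 C1T C2T e1 e2).
Qed.
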